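(* Let $x\in C[0,1]$ be nonconstant and suppose that there exists $r\in(0,1)$ such that $$x\in\bigcap_{\varepsilon>0,\ p\ge1}\mathscr B^{r-\varepsilon}_{p,\infty}[0,1]\ \setminus\bigcup_{\varepsilon>0,\ \frac1{r+\varepsilon}<p<\frac1r}\mathscr B^{r+\varepsilon}_{p,\infty}[0,1].$$ Then $R^-=r$.
   Context: For $p>0$ and $n\in\mathbb N$, let $\langle x\rangle_n^{(p)}:=\sum_{k=0}^{2^n-1}|x((k+1)2^{-n})-x(k2^{-n})|^p$. Define $q^*:=\sup\{p>0:\limsup_{n\uparrow\infty}\langle x\rangle_n^{(p)}=\infty\}$ and $R^-:=1/q^*$ (with $1/\infty:=0$). $\mathscr B^{s}_{p,q}[0,1]$ denotes the usual Besov space on $[0,1]$ (smoothness $s$, integrability $p$, fine index $q$). For $p\ge 1$ and $s\in(1/p,1)$, an equivalent norm on $\mathscr B^{s}_{p,q}[0,1]$ is $\|x\|_{s,p,q}:=|x(0)|\vee\|(a_n)_{n\in\mathbb N_0}\|_{\ell_q}$ with $a_n:=\big(2^{n(ps-1)}\langle x\rangle_n^{(p)}\big)^{1/p}$; in particular, for $q=\infty$, the second term is $\sup_n\big(2^{n(ps-1)}\langle x\rangle_n^{(p)}\big)^{1/p}$. *)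

(* Defs.v *)
From HB Require Import structures.
From mathcomp Require Import all_boot all_order all_algebra.
From mathcomp Require Import all_classical all_reals all_analysis.
Set Implicit Arguments.
Unset Strict Implicit.
Unset Printing Implicit Defensive.
Import Order.TTheory GRing.Theory Num.Theory.
Import numFieldNormedType.Exports.
Local Open Scope classical_set_scope.
Local Open Scope ring_scope.

(* Functions on [0, 1] are total functions R -> R; nothing below looks at       *)
(* their values outside [0, 1].                                                 *)

(* <x>_n^(p) *)
Definition dyadic_pvar (R : realType) (x : R -> R) (p : R) (n : nat) : R :=
  \sum_(0 <= k < 2 ^ n) `|x (k.+1%:R / 2 ^+ n) - x (k%:R / 2 ^+ n)| `^ p.

(* q^*, as an extended real *)
Definition qstar (R : realType) (x : R -> R) : \bar R :=
  ereal_sup [set p%:E | p in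
    [set p : R | 0 < p /\ limn_esup (fun n => (dyadic_pvar x p n)%:E) = +oo%E]].

(* R^- ; the extended inverse satisfies +oo^-1 = 0 *)
Definition Rminus (R : realType) (x : R -> R) : \bar R := ((qstar x)^-1)%E.

(* L_p (quasi-)norm of f over A, for 0 < p < oo *)
Definition Lpnorm (R : realType) (A : set R) (p : R) (f : R -> R) : \bar R :=
  ('N[@lebesgue_measure R]_(p%:E) [(EFin \o f) \_ A])%E.

Definition fwd_diff (R : realType) (h : R) (f : R -> R) : R -> R :=
  fun t => f (t + h) - f t.

(* m-th order L_p modulus of smoothness on [0, 1]: the m-th difference of step  *)
(* h is integrated over those t for which t, ..., t + m h all lie in [0, 1].    *)
Definition Lp_modulus (R : realType) (m : nat) (p : R) (f : R -> R) (t : R) :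
    \bar R :=
  ereal_sup [set Lpnorm `[0, 1 - m%:R * h] p (iter m (fwd_diff h) f)
            | h in `]0, t]].

(* sup_{0 < t <= 1} t^(-s) omega_m(f, t)_p with m = floor(s) + 1 if s >= 0,     *)
(* and m = 1 if s < 0 (Num.truncn vanishes on negative numbers).                *)
Definition besov_seminorm (R : realType) (s p : R) (f : R -> R) : \bar R :=
  ereal_sup [set ((t `^ (- s))%:E * Lp_modulus (Num.truncn s).+1 p f t)%E
            | t in `]0, 1]].

(* B^s_{p,oo}[0,1], 0 < p < oo, as a set of functions (representatives of       *)
(* a.e. classes) in L_p[0,1].  For s > max(0, 1/p - 1) this is the whole Besov  *)
(* space.  For s <= 0 and p >= 1 the Besov space also contains distributions,   *)
(* but all of L_p[0,1] embeds in it; accordingly the seminorm below is then     *)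
(* bounded by a multiple of the L_p norm, as t ranges over ]0, 1] only, and     *)
(* the set is L_p[0,1], the trace of the Besov space on L_p[0,1].               *)
Definition besov_oo (R : realType) (s p : R) : set (R -> R) :=
  [set f : R -> R | measurable_fun (`[0, 1] : set R) f /\
           (Lpnorm `[0%R, 1%R] p f + besov_seminorm s p f < +oo)%E].

(* Main.v *)
Require Import Defs.
From HB Require Import structures.
From mathcomp Require Import all_boot all_order all_algebra.
From mathcomp Require Import all_classical all_reals all_analysis.
From mathcomp Require Import measurable_realfun.
From mathcomp Require Import ring lra.
Set Implicit Arguments.
Unset Strict Implicit.
Unset Printing Implicit Defensive.
Import Order.TTheory GRing.Theory Num.Theory.
Import numFieldNormedType.Exports.
Local Open Scope classical_set_scope.
Local Open Scope ring_scope.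

(** Write p-variation for the sum of the p-th powers of the increments of x
    over the dyadic grid of mesh 2^-n. The critical exponent of x is 1/r because
    the p-variations are bounded for p > 1/r and unbounded for p < 1/r.

    Above 1/r. Membership in every Besov space of smoothness less than r, with
    arbitrarily large integrability, makes the increments of x on the grid of
    mesh 2^-n at most C 2^(-g n), for every g < r ([besov_increments]); this is
    the Morrey embedding of smoothness s and integrability 1/(s - g). With
    g = 1/p < r there are 2^n increments, each of p-th power at most C^p 2^-n,
    so the p-variation is at most C^p ([pvar_bounded]).

    Below 1/r. Suppose that the q-variations are bounded for some q < 1/r, and
    take p > 1 with q < p < 1/r. Since |a|^p = |a|^(p-q) |a|^q, the uniform
    decay of the increments improves boundedness for q into the geometric decay
    2^(-d n) of the p-variation for some d > 0. This forces x to have smoothness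
    s = (1 + d)/p in L_p ([besov_oo_of_increments]); but s > 1/p > r, which is
    excluded ([pvar_infinite_below]).

    Both comparisons between the L_p modulus of smoothness and the grid are
    proved on finite grids. As x is uniformly continuous, on a fine enough grid
    the L_p norm of x(t + h) - x(t) agrees, up to an error as small as needed,
    with a normalised finite p-norm ([lp_le_of_Lpnorm], [Lpnorm_of_lp_le]), and
    what remains is chaining along dyadic scales with Minkowski's inequality.
    The cost of a chain decays geometrically from one scale to the next finer
    one, so the whole chain costs no more than a multiple of its coarsest term. *)

(** * Weighted discrete p-norms *)

(** The sequence [a], cut at length [d], has p-norm at most [E] for the measure
    giving every index the mass [W^-1]. Keeping [W] separate from [d] allows one
    normalisation to be used for subintervals of a grid. *)
Definition lp_le {R : realType} (p W : R) (d : nat) (a : nat -> R) (E : R) :=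
  \sum_(0 <= k < d) `|a k| `^ p <= W * E `^ p.

(** Convexity of the p-th power at the points [a / E] and [b / F], with the
    weights [E / (E + F)] and [F / (E + F)]. *)
Lemma powR_add_le (R : realType) (p a b E F : R) : 1 <= p -> 0 <= a -> 0 <= b ->
  0 < E -> 0 < F ->
  (a + b) `^ p <= (E + F) `^ p *
    (E / (E + F) * (a `^ p / E `^ p) + F / (E + F) * (b `^ p / F `^ p)).
Proof.
move=> p1 a0 b0 E0 F0; have EF0 : 0 < E + F by exact: addr_gt0.
have t01 : 0 <= E / (E + F) <= 1.
  by rewrite divr_ge0 ?(ltW E0) ?(ltW EF0)//= ler_pdivrMr// mul1r lerDl ltW.
have /= := @convex_powR R p p1 (Itv01 (andP t01).1 (andP t01).2) (a / E) (b / F).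
rewrite !inE /= !in_itv /= !andbT => /(_ (divr_ge0 a0 (ltW E0)) (divr_ge0 b0 (ltW F0))) H.
rewrite convRE [X in X `^ _ <= _]convRE /= /unstable.onem in H.
have E1 : 1 - E / (E + F) = F / (E + F) by field; lra.
have E2 : E / (E + F) * (a / E) + F / (E + F) * (b / F) = (a + b) / (E + F).
  by field; apply/and3P; split; lra.
rewrite E1 E2 in H.
have HM : forall u v : R, 0 <= u -> 0 < v -> (u / v) `^ p = u `^ p / v `^ p.
  move=> u v u0 v0; rewrite powRM ?invr_ge0 ?(ltW v0)//.
  by rewrite -(powR_inv1 (ltW v0)) powRAC powR_inv1// powR_ge0.
rewrite !HM// ?addr_ge0// in H.
by rewrite -ler_pdivrMl ?powR_gt0// mulrC.
Qed.

Section lp_le_theory.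
Variables (R : realType) (p : R).
Hypothesis p1 : 1 <= p.
Let p0 : 0 < p. Proof. exact: lt_le_trans p1. Qed.
Implicit Types (a b : nat -> R) (W E F : R) (d : nat).

Lemma lp_le_mono W d a b E F : 0 <= W -> 0 <= E -> E <= F ->
  (forall k, (k < d)%N -> `|a k| <= `|b k|) ->
  lp_le p W d b E -> lp_le p W d a F.
Proof.
move=> W0 E0 EF ab; rewrite /lp_le => H.
apply: (@le_trans _ _ (\sum_(0 <= k < d) `|b k| `^ p)).
  apply: ler_sum_nat => k /andP[_ kd].
  by rewrite ge0_ler_powR ?nnegrE ?ab// ltW.
apply: (le_trans H); rewrite ler_wpM2l// ge0_ler_powR ?nnegrE ?(ltW p0)//.
exact: le_trans EF.
Qed.

Lemma lp_le0 W d a k : lp_le p W d a 0 -> (k < d)%N -> a k = 0.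
Proof.
rewrite /lp_le powR0 ?gt_eqF// mulr0 big_mkord => H kd.
have S0 : \sum_(k < d) `|a k| `^ p = 0.
  by apply/eqP; rewrite eq_le H sumr_ge0// => i _; exact: powR_ge0.
have := psumr_eq0P (fun i _ => powR_ge0 _ _) S0.
by move=> /(_ (Ordinal kd) isT)/powR_eq0_eq0/eqP; rewrite normr_eq0 => /eqP.
Qed.

(** Minkowski's inequality, by summing [powR_add_le]. A vanishing bound is
    treated apart because that lemma divides by the bounds. *)
Lemma lp_leD W d a b E F : 0 <= W -> 0 <= E -> 0 <= F ->
  lp_le p W d a E -> lp_le p W d b F -> lp_le p W d (fun k => a k + b k) (E + F).
Proof.
move=> W0; rewrite le_eqVlt => /predU1P[<- F0 /lp_le0 a0|E0].
  rewrite add0r; apply: lp_le_mono => // k kd; by rewrite a0// add0r.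
rewrite le_eqVlt => /predU1P[<- H /lp_le0 b0|F0].
  rewrite addr0; apply: lp_le_mono H => //; first exact: ltW.
  by move=> k kd; rewrite b0// addr0.
rewrite /lp_le => HE HF; have EF0 : 0 < E + F by exact: addr_gt0.
have /ler_sum_nat := fun k (_ : (0 <= k < d)%N) =>
  @powR_add_le R p _ _ E F p1 (normr_ge0 (a k)) (normr_ge0 (b k)) E0 F0.
rewrite -mulr_sumr big_split/= -!mulr_sumr -!mulr_suml => H.
apply: (@le_trans _ _ (\sum_(0 <= k < d) (`|a k| + `|b k|) `^ p)).
  apply: ler_sum_nat => k _.
  by rewrite ge0_ler_powR ?nnegrE ?ler_normD ?addr_ge0// ltW.
apply: (le_trans H); rewrite mulrC ler_wpM2r ?powR_ge0//.
have -> : W = E / (E + F) * W + F / (E + F) * W by field; lra.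
by rewrite lerD// ler_wpM2l ?divr_ge0 ?(ltW E0) ?(ltW F0) ?(ltW EF0)//;
  rewrite ler_pdivrMr ?powR_gt0.
Qed.

Lemma lp_leN W d a E : lp_le p W d a E -> lp_le p W d (fun k => - a k) E.
Proof. by rewrite /lp_le; under [in X in _ -> X]eq_bigr do rewrite normrN. Qed.

Lemma lp_leB W d a b E F : 0 <= W -> 0 <= E -> 0 <= F ->
  lp_le p W d a E -> lp_le p W d b F -> lp_le p W d (fun k => a k - b k) (E + F).
Proof. by move=> W0 E0 F0 Ha /lp_leN; exact: lp_leD. Qed.

Lemma lp_le_cat d d' a E : lp_le p d%:R d a E ->
  lp_le p d'%:R d' (fun k => a (d + k)%N) E ->
  lp_le p (d + d')%:R (d + d') a E.
Proof.
rewrite /lp_le natrD mulrDl => H H'.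
rewrite (big_cat_nat _ (leq_addr d' d))//= lerD//.
rewrite -{1}[d]add0n big_addn addKn.
by under eq_bigr do rewrite addnC.
Qed.

Lemma lp_le_cst d c E : (0 < d)%N -> 0 <= E ->
  lp_le p d%:R d (fun=> c) E -> `|c| <= E.
Proof.
move=> d0 E0; rewrite /lp_le sumr_const_nat subn0 -[X in X <= _ -> _]mulr_natl.
rewrite ler_pM2l ?ltr0n// leNgt => H; rewrite leNgt; apply: contra H => H.
by rewrite gt0_ltr_powR ?nnegrE.
Qed.

Lemma lp_le_bounded W d a E : d%:R <= W -> 0 <= E ->
  (forall k, (k < d)%N -> `|a k| <= E) -> lp_le p W d a E.
Proof.
move=> dW E0 H; rewrite /lp_le.
apply: (@le_trans _ _ (\sum_(0 <= k < d) E `^ p)).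
  by apply: ler_sum_nat => k /andP[_ kd]; rewrite ge0_ler_powR ?nnegrE ?H// ltW.
by rewrite sumr_const_nat subn0 -[X in X <= _]mulr_natl ler_wpM2r ?powR_ge0.
Qed.

Lemma lp_le_rep W d D a E : (0 < D)%N -> lp_le p W d a E ->
  lp_le p (D%:R * W) (d * D) (fun k => a (k %/ D)%N) E.
Proof.
move=> D0; rewrite /lp_le -mulrA => H.
apply: (@le_trans _ _ (D%:R * \sum_(0 <= k < d) `|a k| `^ p)); last first.
  by rewrite ler_wpM2l.
elim: d {H} => [|d IH]; first by rewrite mul0n !big_geq// mulr0.
rewrite mulSn addnC (big_cat_nat _ (leq_addr D (d * D)))//= [X in _ <= _ * X]big_nat_recr//=.
rewrite mulrDr lerD// -{1}[(d * D)%N]add0n big_addn addKn.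
rewrite (eq_big_nat _ _ (F2 := fun=> `|a d| `^ p)).
  by rewrite sumr_const_nat subn0 mulr_natl.
by move=> k /andP[_ kD]; rewrite addnC divnMDl// divn_small// addn0.
Qed.

Lemma lp_le_sub W d a E y v : lp_le p W d a E -> (y + v <= d)%N ->
  lp_le p W v (fun k => a (y + k)%N) E.
Proof.
move=> H yvd; apply: le_trans H.
have yd : (y <= d)%N by rewrite (leq_trans _ yvd)// leq_addr.
rewrite (big_cat_nat (leq0n y) yd)//= (big_cat_nat (leq_addr v y) yvd)//=.
rewrite addrCA -[leLHS]addr0 lerD//; last by rewrite addr_ge0 ?sumr_ge0// => *; exact: powR_ge0.
rewrite -{2}[y]add0n big_addn addKn le_eqVlt; apply/orP; left; apply/eqP.
by apply: eq_bigr => i _; rewrite addnC.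
Qed.

Lemma lp_le_ext W d a a' E : (forall k, (k < d)%N -> a k = a' k) ->
  lp_le p W d a E -> lp_le p W d a' E.
Proof.
move=> aa'; rewrite /lp_le (eq_big_nat _ _ (F2 := fun k => `|a' k| `^ p))//.
by move=> k /andP[_ kd]; rewrite aa'.
Qed.

(** Used when [a] vanishes at every even index and copies the preceding entry of
    [c] at the odd ones. *)
Lemma lp_le_shift W d a c E :
  a 0%N = 0 -> (forall k, (k.+1 < d)%N -> `|a k.+1| <= `|c k|) ->
  lp_le p W d c E -> lp_le p W d a E.
Proof.
move=> a0 ac; rewrite /lp_le; apply: le_trans.
case: d ac => [|d] ac; first by rewrite !big_geq.
rewrite big_nat_recl// a0 normr0 powR0 ?gt_eqF// add0r [leRHS]big_nat_recr//=.
rewrite -[leLHS]addr0 lerD ?powR_ge0//; apply: ler_sum_nat => k /andP[_ kd].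
by rewrite ge0_ler_powR ?nnegrE ?ac// ltW.
Qed.

End lp_le_theory.

(** * Riemann sums and uniform continuity *)

Section riemann_sums.
Variables (R : realType).
Local Notation mu := (@lebesgue_measure R).

Lemma integral_itv_step (G : R -> \bar R) (e : R) (M : nat) : 0 < e ->
  measurable_fun [set: R] G -> (forall t, 0 <= G t)%E ->
  (\int[mu]_(t in `[0%R, (M.+1%:R * e)%R[) G t =
   \int[mu]_(t in `[0%R, (M%:R * e)%R[) G t +
   \int[mu]_(t in `[(M%:R * e)%R, (M.+1%:R * e)%R[) G t)%E.
Proof.
move=> e0 mG G0; have Me : 0 <= M%:R * e by rewrite mulr_ge0// ltW.
have Me1 : M%:R * e <= M.+1%:R * e by rewrite ler_wpM2r ?ler_nat// ltW.
rewrite -ge0_integral_setU//; last 2 first.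
- exact: measurable_funTS.
- rewrite disj_set2E; apply/eqP; rewrite -subset0 => t /=.
  by rewrite !in_itv/= => -[/andP[_ a] /andP[b _]]; move: (lt_le_trans a b); rewrite ltxx.
congr (integral _ _ _); apply/seteqP; split=> t /=; rewrite !in_itv/=.
  by move=> /andP[t0 tM]; case: (ltP t (M%:R * e)) => tM'; [left|right]; rewrite ?t0 ?tM.
move=> [/andP[t0 tM]|/andP[t0 tM]]; first by rewrite t0 (lt_le_trans tM).
by rewrite (le_trans Me) ?tM.
Qed.

Lemma integral_itv_cst (e c : R) (M : nat) : 0 < e ->
  (\int[mu]_(t in `[(M%:R * e)%R, (M.+1%:R * e)%R[) (cst c%:E t) = (e * c)%:E)%E.
Proof.
move=> e0; have := @lebesgue_measure_itv R `[M%:R * e, M.+1%:R * e[.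
rewrite /= lte_fin ltr_pM2r// ltr_nat ltnSn -EFinB => L.
rewrite integral_cst//; apply: etrans (congr1 (mule c%:E) L) _.
by rewrite -EFinM; congr EFin; rewrite -[M.+1]addn1 natrD; ring.
Qed.

Lemma riemann_le_integral (G : R -> \bar R) (c : nat -> R) (e : R) (M : nat) :
  0 < e -> measurable_fun [set: R] G -> (forall t, 0 <= G t)%E ->
  (forall k, 0 <= c k) ->
  (forall k t, (k < M)%N -> k%:R * e <= t < k.+1%:R * e -> ((c k)%:E <= G t)%E) ->
  ((e * \sum_(0 <= k < M) c k)%:E <= \int[mu]_t G t)%E.
Proof.
move=> e0 mG G0 c0 H; apply: (@le_trans _ _ (\int[mu]_(t in `[0%R, (M%:R * e)%R[) G t)%E).
  elim: M H => [|M IH] H.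
    by rewrite big_geq// mulr0 integral_ge0.
  rewrite integral_itv_step// big_nat_recr//= mulrDr EFinD leeD//.
    by apply: IH => k t kM; apply: H; rewrite ltnS ltnW.
  rewrite -(@integral_itv_cst e (c M) M e0); apply: ge0_le_integral => //.
  - by move=> t _; rewrite lee_fin.
  - exact: measurable_funTS.
  - by move=> t /=; rewrite in_itv/=; apply: H.
by apply: ge0_subset_integral.
Qed.

Lemma integral_le_riemann (G : R -> \bar R) (c : nat -> R) (e : R) (M : nat) :
  0 < e -> measurable_fun [set: R] G -> (forall t, 0 <= G t)%E ->
  (forall k, 0 <= c k) ->
  (forall t, ~ (0 <= t < M%:R * e) -> G t = 0%E) ->
  (forall k t, (k < M)%N -> k%:R * e <= t < k.+1%:R * e -> (G t <= (c k)%:E)%E) ->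
  (\int[mu]_t G t <= (e * \sum_(0 <= k < M) c k)%:E)%E.
Proof.
move=> e0 mG G0 c0 Gout H.
have -> : (\int[mu]_t G t = \int[mu]_(t in `[0%R, (M%:R * e)%R[) G t)%E.
  rewrite [RHS]integral_mkcond; apply: eq_integral => t _.
  rewrite patchE; case: ifPn => // /negP tM; apply: Gout => tM'.
  by apply: tM; rewrite inE/= in_itv.
elim: M H {Gout} => [|M IH] H.
  by rewrite mul0r set_itvco0 integral_set0 big_geq// mulr0.
rewrite integral_itv_step// big_nat_recr//= mulrDr EFinD leeD//.
  by apply: IH => k t kM; apply: H; rewrite ltnS ltnW.
rewrite -(@integral_itv_cst e (c M) M e0); apply: ge0_le_integral => //.
- exact: measurable_funTS.
- by move=> t /=; rewrite in_itv/=; apply: H.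
Qed.

Section Lpnorm_step.
Variables (A : set R) (p : R) (F : R -> R) (E e : R) (M : nat) (c : nat -> R).
Hypotheses (p0 : 0 < p) (mA : measurable A) (mF : measurable_fun A F).
Hypotheses (E0 : 0 <= E) (e0 : 0 < e).

Let G t := (`|((EFin \o F) \_ A) t| `^ p)%E.

Let mG : measurable_fun [set: R] G.
Proof.
rewrite /G; apply: (@measurableT_comp _ _ _ _ _ _ (fun y : \bar R => (y `^ p)%E)).
  exact: measurable_poweR.
apply: measurableT_comp => //; apply/(measurable_restrictT _ mA).
exact/measurable_EFinP.
Qed.

Let G0 t : (0 <= G t)%E. Proof. exact: poweR_ge0. Qed.

Let GA t : A t -> G t = (`|F t| `^ p)%:E.
Proof. by move=> At; rewrite /G patchE mem_set. Qed.

Let GnA t : ~ A t -> G t = 0%E.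
Proof. by move=> At; rewrite /G patchE memNset// abse0 poweR0r// gt_eqF. Qed.

(** Lower Riemann sums: a step function below [F] inherits its L_p bound. *)
Lemma lp_le_of_Lpnorm : (Lpnorm A p F <= E%:E)%E ->
  (forall k t, (k < M)%N -> k%:R * e <= t < k.+1%:R * e -> A t /\ `|c k| <= `|F t|) ->
  lp_le p e^-1 M c E.
Proof.
move=> FE H; rewrite /lp_le ler_pdivlMl//.
rewrite -lee_fin -poweR_EFin.
apply: (@le_trans _ _ (\int[mu]_t G t)%E).
  apply: riemann_le_integral => // k t kM tk.
  have [At cF] := H _ _ kM tk.
  by rewrite GA// lee_fin ge0_ler_powR ?nnegrE// ltW.
rewrite /G -poweR_Lnorm ?gt_eqF//; apply: gt0_ler_poweR => //; first exact: ltW.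
  by rewrite in_itv/= leey Lnorm_ge0.
by rewrite in_itv/= leey lee_fin E0.
Qed.

(** Upper Riemann sums. The last step may stick out of [A], since the integrand
    is extended by zero. *)
Lemma Lpnorm_of_lp_le :
  (forall t, A t -> 0 <= t < M%:R * e) ->
  (forall k t, (k < M)%N -> A t -> k%:R * e <= t < k.+1%:R * e -> `|F t| <= `|c k|) ->
  lp_le p e^-1 M c E -> (Lpnorm A p F <= E%:E)%E.
Proof.
move=> AM H; rewrite /lp_le ler_pdivlMl// => HE.
have : (\int[mu]_t G t <= (E `^ p)%:E)%E.
  apply: le_trans (_ : _ <= (e * \sum_(0 <= k < M) `|c k| `^ p)%:E)%E _.
    apply: integral_le_riemann => // [t Mt|k t kM tk].
      by apply: GnA => /AM.
    have [At|At] := pselect (A t); last by rewrite GnA// lee_fin powR_ge0.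
    by rewrite GA// lee_fin ge0_ler_powR ?nnegrE ?(H _ _ kM)// ltW.
  by rewrite lee_fin.
rewrite /Lpnorm unlock -/(G _) => HI.
have -> : E%:E = ((E `^ p)%:E `^ p^-1)%E.
  by rewrite poweR_EFin -powRrM divff ?gt_eqF// powRr1.
apply: gt0_ler_poweR => //; rewrite ?invr_ge0 ?(ltW p0)// in_itv/= leey andbT.
  by apply: integral_ge0 => t _; exact: poweR_ge0.
by rewrite lee_fin powR_ge0.
Qed.

End Lpnorm_step.

Lemma dyadic_eventually_lt (d : R) : 0 < d ->
  exists N0, forall N, (N0 <= N)%N -> 2 / 2 ^+ N < d.
Proof.
move=> d0; exists (Num.truncn (2 / d)).+1 => N NN.
rewrite ltr_pdivrMr ?exprn_gt0// mulrC -ltr_pdivrMr//.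
rewrite (lt_trans (truncnS_gt _))// (le_lt_trans (_ : _ <= N%:R))// ?ler_nat//.
by rewrite -natrX ltr_nat ltn_expl.
Qed.

(** Heine-Cantor, with the modulus of continuity sampled at dyadic scales. *)
Lemma uniform_dyadic_modulus (x : R -> R) : {within `[0, 1], continuous x} ->
  forall e : R, 0 < e -> exists N0, forall (N : nat) (s t : R), (N0 <= N)%N ->
    0 <= s <= 1 -> 0 <= t <= 1 -> `|s - t| <= 2 / 2 ^+ N -> `|x s - x t| <= e.
Proof.
move=> xc e e0.
have /compact_near_coveringP/near_covering_withinP/= cov := @segment_compact R 0 1.
pose P (N : nat) (s : R) := forall t : R, 0 <= t <= 1 ->
  `|s - t| <= 2 / 2 ^+ N -> `|x s - x t| <= e.
suff /cov[N0 _ HN] : forall u : R, `[0, 1]%classic u ->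
    \forall s \near u & N \near \oo, `[0, 1]%classic s -> P N s.
  exists N0 => N s t NN s01 t01 st; apply: (HN N NN s) => //.
move=> u u01.
have e20 : 0 < e / 2 by rewrite divr_gt0.
have : within `[0, 1] (nbhs u) [set t | `|x u - x t| <= e / 2].
  rewrite nbhs_subspace_in//.
  by have /cvgrPdist_le/(_ _ e20) := xc u.
rewrite /within/= => /nbhs_ballP[d /= d0 Hd].
have d20 : 0 < d / 2 by rewrite divr_gt0.
have [N0 HN] := @dyadic_eventually_lt _ d20.
exists (ball u (d / 2), [set N | (N0 <= N)%N]) => /=.
  by split; [exact: nbhsx_ballx | exists N0].
move=> [s N] /= [us NN] s01 t t01 st.
have sE : `|x u - x s| <= e / 2.
  apply: Hd => //; apply: le_ball us; rewrite ler_pdivrMr//; lra.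
have tE : `|x u - x t| <= e / 2.
  apply: Hd; last by rewrite /= in_itv.
  have := HN _ NN; move: us; rewrite /ball/= => us h.
  rewrite (le_lt_trans (ler_distD s _ _))//.
  by rewrite [ltRHS](splitr d) ltrD// (le_lt_trans st).
rewrite (le_trans (ler_distD (x u) _ _))// distrC.
by rewrite [leRHS](splitr e) lerD.
Qed.

End riemann_sums.

(** * Decay of dyadic increments from smoothness *)

(** The array [b] stands for the values of a function on the grid of mesh 2^-N.
    Its increments of step 2^-i are at most [L * tau ^+ i] in mean over every
    block of length 2^-i, for scales down to 2^-M, and its oscillation at the
    scale 2^-M is at most [w]. Keeping the chain above 2^-M leaves room for the
    discretisation error, which is made small by the choice of [N] after [M]. *)
Section block_oscillation.
Variables (R : realType) (p : R).
Hypothesis p1 : 1 <= p.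
Variables (b : nat -> R) (N M : nat) (tau L L' w : R).
Hypotheses (MN : (M <= N)%N) (tau01 : 0 < tau < 1) (L0 : 0 <= L) (w0 : 0 <= w).
Hypotheses (L'0 : 0 <= L') (LL' : L * tau <= L' * (1 - tau)).
Hypothesis Hb : forall i y, (i <= M)%N -> (y + 2 ^ (N - i) + 2 ^ (N - i) <= 2 ^ N)%N ->
  lp_le p (2 ^ (N - i))%:R (2 ^ (N - i))
    (fun v => b (y + v + 2 ^ (N - i))%N - b (y + v)%N) (L * tau ^+ i).
Hypothesis Hw : forall y v, (v < 2 ^ (N - M))%N -> (y + v <= 2 ^ N)%N ->
  `|b (y + v)%N - b y| <= w.

Let tau0 : 0 < tau. Proof. by case/andP: tau01. Qed.

(** Split a block into its halves: the second half compares to the first through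
    an increment of half the length of the block, so passing from scale i+1 to
    scale i costs [L * tau ^+ i.+1]. By the choice of [L'], these costs telescope
    in [L' * tau ^+ i]. *)
Lemma block_mean_osc i y : (i <= M)%N -> (y + 2 ^ (N - i) <= 2 ^ N)%N ->
  lp_le p (2 ^ (N - i))%:R (2 ^ (N - i)) (fun v => b (y + v)%N - b y)
    (w + L' * (tau ^+ i - tau ^+ M)).
Proof.
move=> iM; rewrite -(subKn iM); move: (M - i)%N (leq_subr i M) => d {i iM}.
elim: d y => [|d IH] y dM.
  rewrite subn0 subrr mulr0 addr0 => yN; apply: lp_le_bounded => // k kd.
  by apply: Hw => //; rewrite (leq_trans _ yN)// leq_add2l ltnW.
set i := (M - d.+1)%N in IH *.
have iE : (M - d)%N = i.+1 by rewrite /i subnSK.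
have iM : (i.+1 <= M)%N by rewrite -iE leq_subr.
rewrite iE in IH.
have DE : (2 ^ (N - i) = 2 ^ (N - i.+1) + 2 ^ (N - i.+1))%N.
  by rewrite addnn -mul2n -expnS; congr expn; rewrite subnSK// (leq_trans iM).
rewrite DE => yN.
have IHy := IH y (ltnW dM) (leq_trans (leq_add (leqnn y) (leq_addr _ _)) yN).
have tM : tau ^+ M <= tau ^+ i.+1.
  by rewrite ler_wiXn2l ?(ltW tau0) ?(ltW (andP tau01).2).
have step : w + L' * (tau ^+ i.+1 - tau ^+ M) + L * tau ^+ i.+1
         <= w + L' * (tau ^+ i - tau ^+ M).
  rewrite exprSr; have := ler_wpM2l (exprn_ge0 i (ltW tau0)) LL'; lra.
have E1 : 0 <= w + L' * (tau ^+ i.+1 - tau ^+ M).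
  by rewrite addr_ge0// mulr_ge0// subr_ge0.
have Li : 0 <= L * tau ^+ i.+1 by rewrite mulr_ge0// exprn_ge0// ltW.
apply: lp_le_cat.
  apply: (lp_le_mono p1 _ _ _ _ IHy) => //.
  by apply: le_trans step; rewrite lerDl.
have yN' := yN; rewrite addnA in yN'.
apply: (lp_le_mono p1 _ _ _ _ (lp_leD p1 _ _ _ IHy (Hb iM yN'))) => //.
  by rewrite addr_ge0.
move=> k kd /=.
rewrite addnA addnAC.
rewrite (_ : _ - b y = b (y + k)%N - b y +
  (b (y + k + 2 ^ (N - i.+1))%N - b (y + k)%N))//.
by ring.
Qed.

(** Both end points are compared to the mean over the block that starts there,
    and the two blocks to each other. Hence the increment is followed by a
    second block inside the grid. *)
Lemma block_increment i y : (i <= M)%N ->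
  (y + 2 ^ (N - i) + 2 ^ (N - i) <= 2 ^ N)%N ->
  `|b (y + 2 ^ (N - i))%N - b y| <= 2 * w + (2 * L' + L) * tau ^+ i.
Proof.
move=> iM yN; set D := (2 ^ (N - i))%N in yN *.
have yN' : (y + D <= 2 ^ N)%N by rewrite (leq_trans _ yN)// leq_addr.
have H1 := block_mean_osc iM yN; have H2 := block_mean_osc iM yN'.
have H3 := Hb iM yN; rewrite -/D in H1 H2 H3.
have tM : tau ^+ M <= tau ^+ i.
  by rewrite ler_wiXn2l ?(ltW tau0) ?(ltW (andP tau01).2).
have E1 : 0 <= w + L' * (tau ^+ i - tau ^+ M).
  by rewrite addr_ge0// mulr_ge0// subr_ge0.
have Li : 0 <= L * tau ^+ i by rewrite mulr_ge0// exprn_ge0// ltW.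
have E2 := addr_ge0 E1 Li.
have D0 : 0 <= D%:R :> R by [].
have H4 := lp_leB p1 D0 Li E1 H3 H1.
have H5 := lp_leD p1 D0 (addr_ge0 Li E1) E1 H4 H2.
apply: le_trans (_ : _ <= (L * tau ^+ i + (w + L' * (tau ^+ i - tau ^+ M)))
  + (w + L' * (tau ^+ i - tau ^+ M))) _.
  apply: (lp_le_cst p1 (d := D)); first by rewrite expn_gt0.
    by rewrite addr_ge0// addr_ge0.
  apply: lp_le_ext H5.
  move=> v _ /=; rewrite (addnAC y D v).
  rewrite (_ : b (y + D)%N - b y = b (y + v + D)%N - b (y + v)%N -
    (b (y + v + D)%N - b (y + D)%N) + (b (y + v)%N - b y))//.
  by ring.
have : 0 <= L' * tau ^+ M by rewrite mulr_ge0// exprn_ge0// ltW.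
lra.
Qed.

End block_oscillation.

Section dyadic_powers.
Variable R : realType.
Implicit Types (p s : R).

Lemma powR_dyadic s i : (2 ^- i) `^ s = (2 `^ (- s)) ^+ i :> R.
Proof.
have H : 2 ^- i = 2 `^ (- i%:R) :> R by symmetry; apply: powR_invn.
rewrite H -powRrM mulNr mulrC -mulNr powRrM powR_mulrn.
  by [].
exact: powR_ge0.
Qed.

Lemma powR_exprn (a : R) p i : 0 <= a -> (a ^+ i) `^ p = (a `^ p) ^+ i.
Proof.
move=> a0; rewrite -(powR_mulrn i a0) powRAC powR_mulrn.
  by [].
exact: powR_ge0.
Qed.

(** Restricting a p-norm from the whole grid of mesh 2^-N to one block of length
    2^-i multiplies it by 2^(i/p) after normalisation. This turns smoothness s
    into the exponent s - 1/p of the Morrey embedding. *)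
Lemma powR_level_scale p s (K : R) N i : 0 < p -> 0 <= K -> (i <= N)%N ->
  (2 ^+ N) * (K * (2 `^ (- s)) ^+ i) `^ p =
  (2 ^ (N - i))%:R * (K * (2 `^ (p^-1 - s)) ^+ i) `^ p.
Proof.
move=> p0 K0 iN; have ge0 z := powR_ge0 2 z : 0 <= 2 `^ z :> R.
rewrite !(powRM _ K0 (exprn_ge0 _ (ge0 _))) !(powR_exprn _ _ (ge0 _)).
have -> : 2 `^ (p^-1 - s) = 2 `^ p^-1 * 2 `^ (- s) :> R.
  by apply: powRD; apply/implyP.
have -> : (2 `^ p^-1 * 2 `^ (- s)) `^ p = 2 * (2 `^ (- s)) `^ p :> R.
  rewrite (powRM _ (ge0 _) (ge0 _)) -powRrM mulVf ?gt_eqF// powRr1//.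
rewrite exprMn natrX.
have -> : 2 ^+ N = 2 ^+ (N - i) * 2 ^+ i :> R by rewrite -exprD subnK.
by move: (K `^ p) => k; ring.
Qed.

End dyadic_powers.

(** For s in ]0, 1[ the modulus is of first order, and taking t = h in the
    supremum that defines the seminorm isolates the difference of step h. *)
Lemma besov_oo_Lpnorm_le (R : realType) (s p : R) (x : R -> R) :
  0 < s < 1 -> besov_oo s p x ->
  exists2 K : R, 0 <= K & forall h : R, 0 < h <= 1 ->
    (Lpnorm `[0%R, (1 - h)%R] p (fwd_diff h x) <= (K * h `^ s)%R%:E)%E.
Proof.
move=> /andP[s0 s1] [mx]; have tr0 : Num.truncn s = 0%N.
  by apply: truncn_def => //; rewrite ltW.
have lb (h : R) : 0 < h <= 1 -> ((h `^ (- s))%:E * Lpnorm `[0%R, (1 - h)%R] p (fwd_diff h x)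
    <= besov_seminorm s p x)%E.
  move=> /andP[h0 h1].
  apply: (@le_trans _ _ ((h `^ (- s))%:E * Lp_modulus (Num.truncn s).+1 p x h)%E).
    rewrite lee_pmul2l ?lte_fin ?powR_gt0//.
    apply: ereal_sup_ubound => /=; exists h; first by rewrite in_itv/= h0 lexx.
    by rewrite tr0 mul1r.
  by apply: ereal_sup_ubound => /=; exists h => //; rewrite in_itv/= h0 h1.
have S0 : (0 <= besov_seminorm s p x)%E.
  apply: le_trans (lb 1 _); last by rewrite ltr01 lexx.
  by apply: mule_ge0; [rewrite lee_fin powR_ge0|exact: Lnorm_ge0].
move=> LS; have Sfin : (besov_seminorm s p x < +oo)%E.
  by apply: le_lt_trans LS; apply: leeDr; exact: Lnorm_ge0.
exists (fine (besov_seminorm s p x)); first exact: fine_ge0.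
move=> h h01; have h0 : 0 < h by case/andP: h01.
have := lb h h01.
rewrite -[X in (_ <= X)%E -> _]fineK ?ge0_fin_numE//.
rewrite powRN lee_pdivrMl ?powR_gt0//.
by rewrite muleC -EFinM.
Qed.

Section grid.
Variables (R : realType) (x : R -> R).

Definition grid (N k : nat) : R := x (k%:R / 2 ^+ N).

Let two_gt0 N : 0 < 2 ^+ N :> R. Proof. exact: exprn_gt0. Qed.

Lemma grid_point01 N k : (k <= 2 ^ N)%N -> 0 <= (k%:R / 2 ^+ N : R) <= 1.
Proof.
move=> kN; rewrite divr_ge0 ?ler0n ?(ltW (two_gt0 N))//=.
by rewrite ler_pdivrMr// mul1r -natrX ler_nat.
Qed.

Lemma grid_coarse N n k : (n <= N)%N -> grid N (k * 2 ^ (N - n)) = grid n k.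
Proof.
move=> nN; rewrite /grid; congr x; rewrite natrM natrX.
rewrite -[X in _ / _ ^+ X](subnK nN) exprD invfM mulrA.
by rewrite mulfK// gt_eqF.
Qed.

Lemma grid_close N M y v : (M <= N)%N -> (v <= 2 ^ (N - M))%N ->
  `|(y + v)%N%:R / 2 ^+ N - y%:R / 2 ^+ N| <= 1 / 2 ^+ M :> R.
Proof.
move=> MN vN; rewrite -mulrBl natrD addrAC subrr add0r ger0_norm; last first.
  by rewrite divr_ge0 ?ler0n// ltW.
rewrite ler_pdivrMr// -[X in _ * _ ^+ X](subnK MN) exprD mulrCA divfK ?gt_eqF//.
by rewrite mulr1 -natrX ler_nat.
Qed.

End grid.

Lemma powR2_lt1 (R : realType) (a : R) : a < 0 -> 0 < (2 `^ a : R) < 1.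
Proof.
move=> a0; rewrite powR_gt0//= -[a]opprK powRN invf_lt1 ?powR_gt0//.
have := @gt0_ltr_powR R (- a); rewrite oppr_gt0 => /(_ a0 1 2).
by rewrite powR1 !nnegrE ler01 ler0n ltr1n; exact.
Qed.

Section increments.
Variables (R : realType) (x : R -> R) (p s K : R).
Hypothesis xc : {within `[0, 1], continuous x}.
Hypotheses (p1 : 1 <= p) (ps : p^-1 < s) (K0 : 0 < K).
Hypothesis xK : forall h : R, 0 < h <= 1 ->
    (Lpnorm `[0%R, (1 - h)%R] p (fwd_diff h x) <= (K * h `^ s)%R%:E)%E.

Let tau : R := 2 `^ (p^-1 - s).
Let tau01 : 0 < tau < 1. Proof. by apply: powR2_lt1; rewrite subr_lt0. Qed.
Let tau0 : 0 < tau. Proof. by case/andP: tau01. Qed.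
Let p0 : 0 < p. Proof. exact: lt_le_trans p1. Qed.

Let measurable_x : measurable_fun (`[0, 1] : set R) x.
Proof. exact: subspace_continuous_measurable_fun. Qed.

Lemma measurable_fwd_diff (h : R) : 0 <= h ->
  measurable_fun (`[0, 1 - h] : set R) (fwd_diff h x).
Proof.
move=> h0; apply: measurable_funB.
  rewrite -[X in measurable_fun _ X]/(x \o (fun t : R => t + h)).
  apply: (measurable_comp _ _ measurable_x) => //.
    by move=> _ [t /= + <-]; rewrite !in_itv/= => /andP[? ?]; apply/andP; split; lra.
  by apply: measurable_funD.
apply: measurable_funS measurable_x => // t /=.
by rewrite !in_itv/= => /andP[? ?]; apply/andP; split; lra.
Qed.

(** If x varies by at most [e] over two mesh lengths, lowering the grid
    increments by [2 * e] puts them below the difference function on the whole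
    cell, so that Riemann sums apply. *)
Lemma grid_lp_le N i (e : R) : (i <= N)%N -> 0 <= e ->
  (forall u v : R, 0 <= u <= 1 -> 0 <= v <= 1 -> `|u - v| <= 2 / 2 ^+ N -> `|x u - x v| <= e) ->
  lp_le p (2 ^+ N) (2 ^ N - 2 ^ (N - i))
   (fun k => Num.max 0 (`|grid x N (k + 2 ^ (N - i)) - grid x N k| - 2 * e))
   (K * (2 `^ (- s)) ^+ i).
Proof.
move=> iN e0 He; set D := (2 ^ (N - i))%N.
have N0 : 0 < 2 ^+ N :> R by rewrite exprn_gt0.
have D2 : (D <= 2 ^ N)%N by rewrite leq_exp2l// leq_subr.
pose h : R := 2 ^- i.
have hD : D%:R / 2 ^+ N = h.
  rewrite /D natrX /h -[X in _ / _ ^+ X](subnK iN) exprD invfM mulrA mulfV ?mul1r//.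
have h01 : 0 < h <= 1.
  by rewrite /h invr_gt0 exprn_gt0//= invf_le1 ?exprn_gt0// exprn_ege1// ler1n.
have h0 : 0 <= h by case/andP: h01 => /ltW.
rewrite -[2 ^+ N]invrK -powR_dyadic -/h.
apply: (@lp_le_of_Lpnorm _ `[0, 1 - h] p (fwd_diff h x)) => //.
- exact: measurable_fwd_diff.
- by rewrite mulr_ge0 ?powR_ge0// ltW.
- exact: xK.
move=> k t kN /andP[kt tk].
have kt1 : (k.+1 + D <= 2 ^ N)%N by rewrite -(subnK D2) leq_add2r.
have kh1 : k.+1%:R / 2 ^+ N + h <= 1.
  by rewrite -hD -mulrDl -natrD; case/andP: (@grid_point01 R _ _ kt1).
have k0 : 0 <= k%:R / 2 ^+ N :> R by rewrite divr_ge0// ltW.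
have kS : k.+1%:R / 2 ^+ N = k%:R / 2 ^+ N + 1 / 2 ^+ N :> R.
  by rewrite -mulrDl -[k.+1]addn1 natrD.
have At : `[0, 1 - h]%classic t by rewrite /= in_itv/=; apply/andP; split; lra.
split=> //; rewrite ger0_norm ?le_max ?lexx// ge_max normr_ge0/=.
rewrite lerBlDr /grid /fwd_diff natrD mulrDl hD.
set u := k%:R / 2 ^+ N in kt kh1 k0 kS *.
have N2 : 0 < 1 / 2 ^+ N :> R by rewrite divr_gt0.
have two : 2 / 2 ^+ N = 1 / 2 ^+ N + 1 / 2 ^+ N :> R by rewrite -mulrDl.
have H1 : `|x (u + h) - x (t + h)| <= e.
  apply: He; [apply/andP; split; lra|apply/andP; split; lra|].
  by rewrite ler_norml; apply/andP; split; lra.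
have H2 : `|x u - x t| <= e.
  apply: He; [apply/andP; split; lra|apply/andP; split; lra|].
  by rewrite ler_norml; apply/andP; split; lra.
rewrite (_ : x (u + h) - x u = (x (t + h) - x t) +
  ((x (u + h) - x (t + h)) - (x u - x t))); last by ring.
apply: (le_trans (ler_normD _ _)); rewrite lerD2l.
by apply: (le_trans (ler_normB _ _)); lra.
Qed.

(** Morrey's embedding on the dyadic grid, except for the last increment. The
    scale [M] is chosen so that x oscillates by at most [tau ^+ n] there, and
    then [N] so that the discretisation error [2 * e] is at most the bound
    [K * tau ^+ M] of the finest increments in the chain. *)
Lemma interior_increment : exists2 C : R, 0 <= C & forall n k, (k.+2 <= 2 ^ n)%N ->
  `|grid x n k.+1 - grid x n k| <= C * tau ^+ n.
Proof.
pose L := 2 * K; pose L' := L * tau / (1 - tau).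
have tau1 : 0 < 1 - tau by rewrite subr_gt0; case/andP: tau01.
have L0 : 0 <= L by rewrite mulr_ge0// ltW.
have L'0 : 0 <= L' by rewrite divr_ge0 ?(ltW tau1)// mulr_ge0// ltW.
have taun n : 0 < tau ^+ n by rewrite exprn_gt0.
exists (2 + (2 * L' + L)); first by rewrite !addr_ge0// mulr_ge0.
move=> n k kn.
have [M0 HM] := uniform_dyadic_modulus xc (taun n).
pose M := maxn n M0; have nM : (n <= M)%N by rewrite leq_maxl.
pose e := K * tau ^+ M / 2; have e0 : 0 < e by rewrite divr_gt0// mulr_gt0.
have [N0 HN] := uniform_dyadic_modulus xc e0.
pose N := maxn M N0; have MN : (M <= N)%N by rewrite leq_maxl.
have nN := leq_trans nM MN.
have N2 m : 0 < 2 ^+ m :> R by rewrite exprn_gt0.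
have eL i : (i <= M)%N -> 2 * e <= K * tau ^+ i.
  move=> iM; rewrite /e mulrCA mulfV ?mulr1// ler_pM2l//.
  by rewrite ler_wiXn2l ?(ltW tau0) ?(ltW (andP tau01).2).
have yN : (k * 2 ^ (N - n) + 2 ^ (N - n) + 2 ^ (N - n) <= 2 ^ N)%N.
  rewrite -addnA addnn -mul2n -mulnDl addn2 -[X in (_ <= 2 ^ X)%N](subnKC nN) expnD.
  by rewrite leq_mul2r kn orbT.
have := @block_increment R p p1 (grid x N) N M tau L L' (tau ^+ n) MN tau01 L0
  (ltW (taun n)) L'0 _ _ _ n (k * 2 ^ (N - n)) nM yN.
rewrite -mulSnr !grid_coarse// => H.
rewrite mulrDl; apply: H.
- by rewrite /L' divfK// gt_eqF.
- move=> i y iM yi; have iN := leq_trans iM MN.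
  set D := (2 ^ (N - i))%N in yi *.
  have HH := grid_lp_le iN (ltW e0) (fun u v => HN N u v (leq_maxr _ _)).
  rewrite -/D in HH.
  have yD : (y + D <= 2 ^ N - D)%N.
    rewrite leq_subRL; first by rewrite addnC.
    by rewrite (leq_trans _ yi)// leq_addl.
  have H1 : lp_le p D%:R D (fun k => Num.max 0
      (`|grid x N (y + k + D) - grid x N (y + k)| - 2 * e)) (K * tau ^+ i).
    by have := lp_le_sub HH yD; rewrite /lp_le powR_level_scale ?(ltW K0).
  have H2 : lp_le p D%:R D (fun=> 2 * e) (K * tau ^+ i).
    apply: lp_le_bounded => // [|j _]; first by rewrite mulr_ge0// ltW.
    by rewrite ger0_norm ?eL// mulr_ge0// ltW.
  have Kt : 0 <= K * tau ^+ i by rewrite mulr_ge0// ltW.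
  apply: (lp_le_mono p1 _ _ _ _ (lp_leD p1 _ Kt Kt H1 H2)) => //.
  + by rewrite addr_ge0.
  + by rewrite /L -mulrA [X in _ <= X]mulr_natl mulr2n.
  move=> v vD; rewrite [X in _ <= X]ger0_norm; last first.
    by rewrite addr_ge0 ?le_max ?lexx// mulr_ge0// ltW.
  by rewrite -lerBlDr le_max lexx orbT.
- move=> y v vM yvN; apply: (HM M); rewrite ?leq_maxr ?grid_point01//.
    by rewrite (leq_trans _ yvN)// leq_addr.
  apply: le_trans (grid_close _ _ MN (ltnW vM)) _.
  by rewrite ler_pM2r ?invr_gt0// ler1n.
Qed.

End increments.

(** The last increment of each grid is not followed by a second block. It is
    recovered from the interior ones by walking to 1 through the points 1 - 2^-m,
    which are consecutive interior points of the finer grids. *)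
Section all_increments.
Variables (R : realType) (x : R -> R) (tau C : R).
Hypothesis xc : {within `[0, 1], continuous x}.
Hypotheses (tau01 : 0 < tau < 1) (C0 : 0 <= C).
Hypothesis xC : forall n k, (k.+2 <= 2 ^ n)%N ->
  `|grid x n k.+1 - grid x n k| <= C * tau ^+ n.

Lemma all_increments : exists2 C' : R, 0 <= C' & forall n k, (k < 2 ^ n)%N ->
  `|grid x n k.+1 - grid x n k| <= C' * tau ^+ n.
Proof.
have tau0 : 0 < tau by case/andP: tau01.
have tau1 : 0 < 1 - tau by rewrite subr_gt0; case/andP: tau01.
have taun n : 0 < tau ^+ n by rewrite exprn_gt0.
pose z m := grid x m (2 ^ m).-1.
have zS m : `|z m.+1 - z m| <= C * tau ^+ m.+1.
  have E : ((2 ^ m).-1 * 2).+2 = (2 ^ m.+1)%N.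
    by rewrite -[_.+2]addn2 -mulSnr prednK ?expn_gt0// expnSr.
  have := @xC m.+1 ((2 ^ m).-1 * 2)%N; rewrite E => /(_ (leqnn _)).
  have -> : grid x m.+1 ((2 ^ m).-1 * 2).+1 = z m.+1 by rewrite /z -E.
  by have := grid_coarse x (2 ^ m).-1 (leqnSn m); rewrite subSnn expn1 => ->.
pose C1 := C * tau / (1 - tau).
have C10 : 0 <= C1 by rewrite divr_ge0 ?(ltW tau1)// mulr_ge0// ltW.
have zn n d : `|z (n + d)%N - z n| <= C1 * (tau ^+ n - tau ^+ (n + d)).
  elim: d => [|d IH]; first by rewrite addn0 !subrr normr0 mulr0.
  rewrite addnS (le_trans (ler_distD (z (n + d)%N) _ _))//.
  apply: (le_trans (lerD (zS _) IH)).
  have -> : C * tau ^+ (n + d).+1 = C1 * (1 - tau) * tau ^+ (n + d).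
    by rewrite /C1 divfK ?gt_eqF// exprS mulrA.
  by rewrite exprS le_eqVlt; apply/orP; left; apply/eqP; ring.
exists (C + (C1 + 1)); first by rewrite !addr_ge0.
move=> n k kn; have [kn2|kn2] := leqP k.+2 (2 ^ n).
  apply: (le_trans (xC kn2)); rewrite ler_pM2r//.
  by rewrite lerDl addr_ge0.
have kE : (2 ^ n)%N = k.+1 by apply/eqP; rewrite eqn_leq kn andbT -ltnS.
have g1 m : grid x m (2 ^ m) = x 1.
  by rewrite /grid natrX divff// gt_eqF// exprn_gt0.
have -> : grid x n k = z n by rewrite /z kE.
rewrite -kE g1.
have [M0 HM] := uniform_dyadic_modulus xc (taun n).
rewrite (le_trans (ler_distD (z (n + M0)%N) _ _))//.
have H1 : `|x 1 - z (n + M0)%N| <= tau ^+ n.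
  rewrite -(g1 (n + M0)%N); set m := (n + M0)%N.
  have m0 : (0 < 2 ^ m)%N by rewrite expn_gt0.
  apply: (HM m); rewrite ?leq_addl ?grid_point01 ?leq_pred//.
  rewrite -{1}(prednK m0) -addn1.
  apply: le_trans (grid_close _ _ (leqnn m) _) _; first by rewrite subnn.
  by rewrite ler_pM2r ?invr_gt0 ?exprn_gt0// ler1n.
apply: (le_trans (lerD H1 (zn n M0))).
have : 0 <= C1 * tau ^+ (n + M0) by rewrite mulr_ge0// ltW.
have : 0 <= C * tau ^+ n by rewrite mulr_ge0// ltW.
lra.
Qed.

End all_increments.

Lemma besov_increments (R : realType) (x : R -> R) (r : R) :
  {within `[0, 1], continuous x} -> 0 < r < 1 ->
  (forall e p : R, 0 < e -> 1 <= p -> besov_oo (r - e) p x) ->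
  forall g : R, 0 < g < r -> exists2 C : R, 0 <= C & forall n k, (k < 2 ^ n)%N ->
  `|grid x n k.+1 - grid x n k| <= C * (2 `^ (- g)) ^+ n.
Proof.
move=> xc /andP[r0 r1] xB g /andP[g0 gr].
(* This p makes the Morrey exponent s - 1/p equal to g. *)
pose s := (g + r) / 2; pose p := (s - g)^-1.
have gs : g < s by rewrite /s ltr_pdivlMr//; lra.
have sr : s < r by rewrite /s ltr_pdivrMr//; lra.
have sg0 : 0 < s - g by rewrite subr_gt0.
have p1 : 1 <= p by rewrite /p invf_ge1// lerBlDr; lra.
have rs0 : 0 < r - s by rewrite subr_gt0.
have s01 : 0 < s < 1 by apply/andP; split; lra.
have := xB _ p rs0 p1; rewrite subKr => /(besov_oo_Lpnorm_le s01)[K K0 xK].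
have pg : p^-1 - s = - g by rewrite /p invrK; lra.
have ps : p^-1 < s by rewrite /p invrK; lra.
have K10 : 0 < K + 1 by rewrite ltr_wpDl.
have [|C C0 HC] := @interior_increment R x p s (K + 1) xc p1 ps K10.
  move=> h h01; apply: le_trans (xK h h01) _.
  by rewrite lee_fin ler_wpM2r ?powR_ge0// lerDl.
rewrite pg in HC.
apply: (all_increments xc _ C0 HC).
by apply: powR2_lt1; rewrite oppr_lt0.
Qed.

(** * Smoothness from decay of the dyadic p-variation *)

Section chaining.
Variables (R : realType) (x : R -> R) (p s L : R).
Hypothesis xc : {within `[0, 1], continuous x}.
Hypotheses (p1 : 1 <= p) (s01 : 0 < s < 1) (L0 : 0 < L).

Let sg : R := 2 `^ (- s).
Let sg01 : 0 < sg < 1.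
Proof. by apply: powR2_lt1; rewrite oppr_lt0; case/andP: s01. Qed.
Let sg0 : 0 < sg. Proof. by case/andP: sg01. Qed.
Let sgn n : 0 < sg ^+ n. Proof. exact: exprn_gt0. Qed.
Let s0 : 0 < s. Proof. by case/andP: s01. Qed.
Let p0 : 0 < p. Proof. exact: lt_le_trans p1. Qed.
Let sg1 : 0 < 1 - sg. Proof. by rewrite subr_gt0; case/andP: sg01. Qed.

Hypothesis xL : forall n, lp_le p (2 ^+ n) (2 ^ n)
  (fun k => grid x n k.+1 - grid x n k) (L * sg ^+ n).

Let L' := L * sg / (1 - sg).
Let L'0 : 0 <= L'. Proof. by rewrite divr_ge0 ?(ltW sg1)// mulr_ge0// ltW. Qed.

(** Rounding an index down to an even one changes it at odd indices only, where
    the value jumps by one increment of the grid. *)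
Lemma chain_one_level N : lp_le p (2 ^+ N.+1) (2 ^ N.+1)
  (fun k => grid x N.+1 k - grid x N (k %/ 2)) (L * sg ^+ N.+1).
Proof.
apply: (lp_le_shift p1 _ _ (xL N.+1)) => //.
  have := grid_coarse x 0 (leqnSn N); rewrite mul0n div0n => ->.
  by rewrite subrr.
move=> k _; have := grid_coarse x (k.+1 %/ 2) (leqnSn N).
rewrite subSnn expn1 => <-.
have [ok|ek] := boolP (odd k).
  have -> : (k.+1 %/ 2 * 2 = k.+1)%N by rewrite divnK// dvdn2/= negbK.
  by rewrite subrr normr0.
have -> // : (k.+1 %/ 2 * 2 = k)%N.
rewrite divn2 /= uphalf_half (negbTE ek) add0n muln2.
by rewrite even_halfK.
Qed.

(** Rounding down from mesh 2^-(n+d) to mesh 2^-n one scale at a time; the costs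
    of the scales telescope as in [block_mean_osc]. *)
Lemma chain_le n d : lp_le p (2 ^+ (n + d)) (2 ^ (n + d))
  (fun k => grid x (n + d) k - grid x n (k %/ 2 ^ d))
  (L' * (sg ^+ n - sg ^+ (n + d))).
Proof.
elim: d => [|d IH].
  rewrite addn0 subrr mulr0; apply: lp_le_bounded => // [|k _]; first by rewrite natrX.
  by rewrite expn0 divn1 subrr normr0.
rewrite addnS.
have W0 : 0 <= 2 ^+ (n + d).+1 :> R by rewrite exprn_ge0.
have E1 : 0 <= L * sg ^+ (n + d).+1 by rewrite mulr_ge0// ltW.
have E2 : 0 <= L' * (sg ^+ n - sg ^+ (n + d)).
  rewrite mulr_ge0// subr_ge0 ler_wiXn2l ?leq_addr ?(ltW sg0)//.
  by rewrite ltW//; case/andP: sg01.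
have := lp_le_rep (D := 2) isT IH; rewrite -exprS -expnSr => IH2.
have -> : L' * (sg ^+ n - sg ^+ (n + d).+1) =
    L * sg ^+ (n + d).+1 + L' * (sg ^+ n - sg ^+ (n + d)).
  have -> : L * sg ^+ (n + d).+1 = L' * (1 - sg) * sg ^+ (n + d).
    by rewrite /L' divfK ?gt_eqF// exprS mulrA.
  by rewrite exprS; ring.
apply: lp_le_ext (lp_leD p1 W0 E1 E2 (chain_one_level (n + d)) IH2) => k _ /=.
by rewrite addrA subrK expnS divnMA.
Qed.

(** The right end point of the grid is rounded to itself and adds nothing. *)
Lemma chain_le_closed n N : (n <= N)%N -> lp_le p (2 ^+ N) (2 ^ N).+1
  (fun k => grid x N k - grid x n (k %/ 2 ^ (N - n))) (L' * sg ^+ n).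
Proof.
move=> nN; have := chain_le n (N - n); rewrite subnKC// => H.
have H1 : lp_le p (2 ^+ N) (2 ^ N)
      (fun k => grid x N k - grid x n (k %/ 2 ^ (N - n))) (L' * sg ^+ n).
  apply: (lp_le_mono p1 _ _ _ _ H) => //.
    rewrite mulr_ge0// subr_ge0 ler_wiXn2l// ?(ltW sg0)//.
    by rewrite ltW//; case/andP: sg01.
  by rewrite ler_wpM2l// lerBlDr lerDl ltW.
rewrite /lp_le big_nat_recr//=.
have -> : (2 ^ N %/ 2 ^ (N - n) = 2 ^ n)%N.
  by rewrite -{1}(subnKC nN) expnD mulnK// expn_gt0.
have := grid_coarse x (2 ^ n) nN; rewrite -expnD subnKC// => ->.
by rewrite subrr normr0 powR0 ?gt_eqF// addr0.
Qed.

(** When two points are at distance at most 2^-n, their roundings to the grid of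
    mesh 2^-n are equal or adjacent. So a shift costs two chains and at most one
    increment of that grid, each such increment being used at most [D] times. *)
Lemma shifted_grid_le n N m : (n <= N)%N -> (0 < m <= 2 ^ (N - n))%N ->
  lp_le p (2 ^+ N) (2 ^ N - m).+1
    (fun k => grid x N (k + m) - grid x N k) ((2 * L' + L) * sg ^+ n).
Proof.
move=> nN /andP[m0 mD]; set D := (2 ^ (N - n))%N in mD *.
have D0 : (0 < D)%N by rewrite expn_gt0.
have mN : (m <= 2 ^ N)%N by rewrite (leq_trans mD)// leq_exp2l// leq_subr.
have W0 : 0 <= 2 ^+ N :> R by rewrite exprn_ge0.
have H := chain_le_closed nN; rewrite -/D in H.
have H1 := @lp_le_sub _ _ _ _ _ _ m (2 ^ N - m).+1 H.
have H2 := @lp_le_sub _ _ _ _ _ _ 0 (2 ^ N - m).+1 H.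
have H3 : lp_le p (2 ^+ N) (2 ^ N - m).+1
   (fun k => grid x n ((k + m) %/ D) - grid x n (k %/ D)) (L * sg ^+ n).
  have := lp_le_rep D0 (xL n).
  have DN : (2 ^ n * D = 2 ^ N)%N by rewrite -expnD subnKC.
  have -> : D%:R * 2 ^+ n = 2 ^+ N :> R by rewrite -natrX -natrM mulnC DN natrX.
  rewrite DN => H3.
  have md : (0 + (2 ^ N - m).+1 <= 2 ^ N)%N.
    by rewrite add0n -subSn// leq_subLR addnC -addn1 leq_add2l.
  apply: (lp_le_mono p1 _ _ _ _ (lp_le_sub H3 md)) => //; first by rewrite mulr_ge0// ltW.
  move=> k kd; rewrite add0n.
  have [->|->] : ((k + m) %/ D = k %/ D \/ (k + m) %/ D = (k %/ D).+1)%N.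
  - rewrite {1 3}(divn_eq k D) -addnA !divnMDl//.
    have : (((k %% D) + m) %/ D < 2)%N.
      by rewrite ltn_divLR// mul2n -addnn -addSn leq_add// ltn_mod.
    by case: (_ %/ _)%N => [|[|//]] _; [left; rewrite addn0|right; rewrite addn1].
  - by rewrite subrr normr0.
  - by [].
have E1 : 0 <= L' * sg ^+ n by rewrite mulr_ge0// ltW.
have E2 : 0 <= L * sg ^+ n by rewrite mulr_ge0// ltW.
have H12 := lp_leB p1 W0 E1 E1 (H1 _) (H2 _).
have -> : (2 * L' + L) * sg ^+ n = (L' * sg ^+ n + L' * sg ^+ n) + L * sg ^+ n by ring.
apply: lp_le_ext (lp_leD p1 W0 (addr_ge0 E1 E1) E2 (H12 _ _) H3) => [k _ /=||].
- rewrite add0n (addnC m k).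
  by ring.
- by rewrite addnS subnKC.
- by rewrite add0n ltnS leq_subr.
Qed.

Lemma exists_dyadic_scale (h : R) : 0 < h <= 1 ->
  exists n, 2 ^- n.+1 < h <= 2 ^- n.
Proof.
move=> /andP[h0 h1].
have [N0 HN] := @dyadic_eventually_lt R h h0.
have exN : exists n, 2 ^- n < h.
  exists N0; apply: le_lt_trans (HN N0 (leqnn _)).
  by rewrite ler_peMl ?ler1n// invr_ge0 exprn_ge0.
case: (ex_minnP exN) => [[|n]] hn nmin.
  by move: hn; rewrite expr0 invr1 ltNge h1.
exists n; rewrite hn/= leNgt; apply/negP => /nmin.
by rewrite ltnn.
Qed.

(** For h between 2^-(n+1) and 2^-n, replace t by the grid point below it and h
    by the multiple [m] of the mesh below it. The mesh is chosen so that both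
    replacements move x by at most [sg ^+ n], which is comparable to [h `^ s]. *)
Lemma fwd_diff_Lpnorm_le : exists2 C : R, 0 <= C & forall h : R, 0 < h <= 1 ->
  (Lpnorm `[0%R, (1 - h)%R] p (fwd_diff h x) <= (C * h `^ s)%R%:E)%E.
Proof.
pose C0 := 2 * L' + L + 2.
have C00 : 0 <= C0 by rewrite !addr_ge0// ?(ltW L0)// mulr_ge0.
exists (C0 * 2 `^ s); first by rewrite mulr_ge0// powR_ge0.
move=> h h01; have /andP[h0 h1] := h01.
have [n /andP[hn nh]] := exists_dyadic_scale h01.
have [N0 HN0] := uniform_dyadic_modulus xc (sgn n).
pose N := maxn n.+1 N0; have nN : (n < N)%N by rewrite leq_maxl.
have HN u v := HN0 N u v (leq_maxr _ _).
have tw k : 0 < 2 ^+ k :> R by rewrite exprn_gt0.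
have N1 : 0 < (2 ^+ N)^-1 :> R by rewrite invr_gt0.
pose m := Num.truncn (h * 2 ^+ N).
have /andP[mh hm] : m%:R <= h * 2 ^+ N < m.+1%:R.
  by apply: truncn_itv; rewrite mulr_ge0 ?ltW.
have m0 : (0 < m)%N.
  rewrite -ltnS -(ltr_nat R); apply: le_lt_trans hm.
  rewrite -ler_pdivrMr// mul1r; apply: le_trans (ltW hn).
  by rewrite lef_pV2 ?posrE// ler_weXn2l// ler1n.
have mD : (m <= 2 ^ (N - n))%N.
  rewrite -(ler_nat R); apply: (le_trans mh).
  rewrite -ler_pdivlMr// natrX -[X in _ / 2 ^+ X](subnK (ltnW nN)).
  by rewrite exprD invfM mulrA mulfV ?mul1r// gt_eqF.
have mN : (m <= 2 ^ N)%N by rewrite (leq_trans mD)// leq_exp2l// leq_subr.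
have mhN : m%:R / 2 ^+ N <= h by rewrite ler_pdivrMr.
have hmN : h < m%:R / 2 ^+ N + 1 / 2 ^+ N.
  by rewrite -mulrDl natr1 ltr_pdivlMr.
apply: (@le_trans _ _ (C0 * sg ^+ n)%:E); last first.
  rewrite lee_fin -mulrA ler_wpM2l//.
  rewrite -powRM ?(ltW h0)// /sg -powR_dyadic ge0_ler_powR ?(ltW s0) ?nnegrE//.
    by rewrite mulr_ge0// ltW.
  by move: (ltW hn); rewrite exprS invfM ler_pdivrMl.
pose c k := `|grid x N (k + m) - grid x N k| + 2 * sg ^+ n.
apply: (@Lpnorm_of_lp_le R _ p (fwd_diff h x) _ (2 ^+ N)^-1 (2 ^ N - m).+1 c) => //.
- by apply: measurable_fwd_diff => //; exact: ltW.
- by rewrite mulr_ge0// ltW.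
- move=> t /=; rewrite in_itv/= => /andP[t0 t1]; rewrite t0/=.
  have -> : (2 ^ N - m).+1%:R / 2 ^+ N = 1 - m%:R / 2 ^+ N + 1 / 2 ^+ N :> R.
    rewrite -[_.+1]addn1 natrD natrB// natrX.
    by field; rewrite gt_eqF.
  lra.
- move=> k t kM /=; rewrite in_itv/= => /andP[t0 t1] /andP[kt tk].
  have kmN : (k + m <= 2 ^ N)%N by rewrite -(subnK mN) leq_add2r.
  have kN : (k <= 2 ^ N)%N by rewrite (leq_trans _ kmN)// leq_addr.
  have gk := @grid_point01 R _ _ kN; have gkm := @grid_point01 R _ _ kmN.
  rewrite natrD mulrDl in gkm.
  have kS : k.+1%:R / 2 ^+ N = k%:R / 2 ^+ N + 1 / 2 ^+ N :> R.
    by rewrite -mulrDl -[k.+1]addn1 natrD.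
  rewrite kS in tk.
  have two : 2 / 2 ^+ N = 1 / 2 ^+ N + 1 / 2 ^+ N :> R by rewrite -mulrDl.
  have N2 : 0 < 1 / 2 ^+ N :> R by rewrite divr_gt0.
  have H1 : `|x (t + h) - grid x N (k + m)| <= sg ^+ n.
    rewrite /grid natrD mulrDl; apply: HN => //; first by apply/andP; split; lra.
    by rewrite ler_norml; apply/andP; split; lra.
  have H2 : `|x t - grid x N k| <= sg ^+ n.
    rewrite /grid; apply: HN => //; first by apply/andP; split; lra.
    by rewrite ler_norml; apply/andP; split; lra.
  rewrite /c [X in _ <= X]ger0_norm ?addr_ge0 ?mulr_ge0 ?(ltW (sgn n))//.
  rewrite /fwd_diff (_ : x (t + h) - x t = (grid x N (k + m) - grid x N k) +
    ((x (t + h) - grid x N (k + m)) - (x t - grid x N k))); last by ring.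
  apply: (le_trans (ler_normD _ _)); rewrite lerD2l.
  by apply: (le_trans (ler_normB _ _)); lra.
have H1 := shifted_grid_le (ltnW nN) (introT andP (conj m0 mD)).
have H2 : lp_le p (2 ^+ N) (2 ^ N - m).+1 (fun=> 2 * sg ^+ n) (2 * sg ^+ n).
  apply: lp_le_bounded => // [||k _].
  - by rewrite -natrX ler_nat -subSn// leq_subLR -[X in (X <= _)%N]addn1 addnC leq_add2r.
  - by rewrite mulr_ge0// ltW.
  - by rewrite ger0_norm// mulr_ge0// ltW.
have W0 : 0 <= 2 ^+ N :> R by rewrite ltW.
have E1 : 0 <= (2 * L' + L) * sg ^+ n.
  by rewrite mulr_ge0 ?(ltW (sgn n))// addr_ge0 ?(ltW L0)// mulr_ge0.
have E2 : 0 <= 2 * sg ^+ n by rewrite mulr_ge0// ltW.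
rewrite invrK (_ : C0 * _ = (2 * L' + L) * sg ^+ n + 2 * sg ^+ n); last first.
  by rewrite -mulrDl.
apply: (lp_leD p1 W0 E1 E2 _ H2).
by move: H1; rewrite /lp_le; under [in X in _ -> X]eq_bigr do rewrite normr_id.
Qed.

Lemma besov_oo_of_increments : besov_oo s p x.
Proof.
have mx : measurable_fun (`[0, 1] : set R) x.
  exact: subspace_continuous_measurable_fun.
split=> //; have [C C0 HC] := fwd_diff_Lpnorm_le.
have tr0 : Num.truncn s = 0%N.
  by apply: truncn_def; case/andP: s01 => a b; rewrite ltW.
apply: lte_add_pinfty.
  have [a _ Ha] := EVT_max ler01 xc.
  have [b _ Hb] := EVT_min ler01 xc.
  pose B := `|x a| + `|x b|.
  have B0 : 0 <= B by rewrite addr_ge0.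
  apply: (@le_lt_trans _ _ ((2 * B `^ p) `^ p^-1)%:E); last exact: ltry.
  apply: (@Lpnorm_of_lp_le R _ p x _ 1 2 (fun=> B)) => //.
  - exact: powR_ge0.
  - by move=> t /=; rewrite in_itv/= => /andP[? ?]; apply/andP; split; lra.
  - move=> k t _ /=  t01 _; rewrite [X in _ <= X]ger0_norm//.
    have := Ha t t01; have := Hb t t01; rewrite /B ler_norml.
    have := ler_norm (x a); have := lerNnormlW (lexx `|x b|).
    have := normr_ge0 (x a); have := normr_ge0 (x b).
    by move=> *; apply/andP; split; lra.
  - rewrite /lp_le sumr_const_nat subn0 invr1 mul1r -powRrM mulVf ?gt_eqF//.
    by rewrite powRr1 ?mulr_ge0 ?powR_ge0// ger0_norm// mulr_natl.
apply: (@le_lt_trans _ _ C%:E); last exact: ltry.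
apply: ge_ereal_sup => _ [t /= + <-]; rewrite in_itv/= => /andP[t0 t1].
rewrite powRN lee_pdivrMl ?powR_gt0//.
apply: ge_ereal_sup => _ [h /= + <-]; rewrite in_itv/= => /andP[h0 ht].
rewrite tr0 mul1r; apply: le_trans (HC h _) _.
  by rewrite h0 (le_trans ht).
rewrite -EFinM lee_fin mulrC ler_wpM2r//.
by rewrite ge0_ler_powR ?nnegrE// ltW.
Qed.

End chaining.

(** * The critical exponent *)

Lemma limn_esup_ltyP (R : realType) (u : nat -> R) :
  limn_esup (fun n => (u n)%:E) != +oo%E <-> exists B, forall n, u n <= B.
Proof.
rewrite /limn_esup limf_esupE; split.
  rewrite -ltey => /ereal_inf_lt[_ [V [N _ NV] <-]] Vfin.
  have [B HB] : exists B, forall n, (N <= n)%N -> u n <= B.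
    exists (fine (ereal_sup [set (u n)%:E | n in V])) => n Nn.
    have un : ((u n)%:E <= ereal_sup [set (u n)%:E | n in V])%E.
      by apply: ereal_sup_ubound; exists n => //; exact: NV.
    rewrite -lee_fin fineK// fin_numElt Vfin andbT.
    by apply: lt_le_trans un; rewrite ltNyr.
  exists (`|B| + \sum_(i < N) `|u i|) => n.
  have S0 (P : pred 'I_N) : 0 <= \sum_(i < N | P i) `|u i| by rewrite sumr_ge0.
  have [Nn|nN] := leqP N n.
    by rewrite (le_trans (HB n Nn))// (le_trans (ler_norm B))// lerDl S0.
  rewrite (bigD1 (Ordinal nN))//= addrCA (le_trans (ler_norm (u n)))// lerDl.
  by rewrite addr_ge0.
move=> [B HB]; rewrite -ltey; apply: (@le_lt_trans _ _ B%:E); last exact: ltry.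
apply: (@le_trans _ _ (ereal_sup [set (u n)%:E | n in setT])).
  by apply: ereal_inf_lbound => /=; exists setT => //; exact: filterT.
by apply: ge_ereal_sup => _ [n _ <-]; rewrite lee_fin.
Qed.

(** The decay [2 `^ (- (g * p) * n)] of the terms compensates their number
    [2 ^ n] as soon as g p is at least 1. *)
Lemma pvar_bounded (R : realType) (x : R -> R) (g p C : R) : 0 <= C ->
  1 <= g * p -> 0 < p ->
  (forall n k, (k < 2 ^ n)%N ->
    `|grid x n k.+1 - grid x n k| <= C * (2 `^ (- g)) ^+ n) ->
  forall n, dyadic_pvar x p n <= C `^ p.
Proof.
move=> C0 gp p0 xC n.
have ge0 z := powR_ge0 2 z : 0 <= 2 `^ z :> R.
have H : lp_le p (2 ^+ n) (2 ^ n) (fun k => grid x n k.+1 - grid x n k)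
    (C * (2 `^ (- g)) ^+ n).
  rewrite /lp_le; apply: (@le_trans _ _ (\sum_(0 <= k < 2 ^ n) (C * (2 `^ (- g)) ^+ n) `^ p)).
    apply: ler_sum_nat => k /andP[_ kn].
    by rewrite ge0_ler_powR ?nnegrE ?xC ?(ltW p0)// mulr_ge0// exprn_ge0.
  by rewrite sumr_const_nat subn0 -natrX -[X in X <= _]mulr_natl.
apply: (le_trans H).
rewrite (powRM _ C0 (exprn_ge0 _ (ge0 _))) (powR_exprn _ _ (ge0 _)) mulrCA.
rewrite -[X in _ <= X]mulr1 ler_wpM2l ?powR_ge0// -exprMn.
apply: exprn_ile1; first by rewrite mulr_ge0 ?powR_ge0.
rewrite -powRrM mulNr powRN ler_pdivrMr ?powR_gt0// mul1r.
by apply: le1r_powR => //; rewrite ler1n.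
Qed.

Section critical_exponent.
Variables (R : realType) (x : R -> R) (r : R).
Hypothesis xc : {within `[0, 1], continuous x}.
Hypothesis r01 : 0 < r < 1.
Hypothesis xB : forall e p : R, 0 < e -> 1 <= p -> besov_oo (r - e) p x.
Hypothesis xNB : forall e p : R, 0 < e -> (r + e)^-1 < p < r^-1 ->
  ~ besov_oo (r + e) p x.

Let r0 : 0 < r. Proof. by case/andP: r01. Qed.
Let r1 : 1 < r^-1. Proof. by rewrite invf_gt1//; case/andP: r01. Qed.

(** If the q-variations were bounded by [B], then for p > q the increments, of
    size at most [C * 2 ^- (r n / 2)], would give the p-variation the bound
    [C `^ (p - q) * 2 `^ (- (r / 2) * (p - q) * n) * B], and x would have
    smoothness (1 + d)/p > r in L_p for a small d > 0. *)
Lemma pvar_infinite_below (q : R) : 0 < q < r^-1 ->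
  limn_esup (fun n => (dyadic_pvar x q n)%:E) = +oo%E.
Proof.
move=> /andP[q0 qr]; apply/eqP; apply/negPn/negP => /limn_esup_ltyP[B HB].
pose p := (Num.max q 1 + r^-1) / 2.
have m1 : 1 <= Num.max q 1 by rewrite le_max lexx orbT.
have mq : q <= Num.max q 1 by rewrite le_max lexx.
have mr : Num.max q 1 < r^-1 by rewrite gt_max qr.
have mp : Num.max q 1 < p by rewrite /p ltr_pdivlMr//; lra.
have pr : p < r^-1 by rewrite /p ltr_pdivrMr//; lra.
have p1 : 1 < p := le_lt_trans m1 mp.
have qp : q < p := le_lt_trans mq mp.
have p0 : 0 < p := lt_trans ltr01 p1.
have r20 : 0 < r / 2 < r.
  by rewrite divr_gt0//= ltr_pdivrMr//; move: r0; lra.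
have [C C0 xC] := besov_increments xc r01 xB r20.
(* The first bound is the decay rate at hand; the second one keeps s below 1. *)
pose d := Num.min (r / 2 * (p - q)) ((p - 1) / 2).
have d0 : 0 < d by rewrite lt_min mulr_gt0 ?divr_gt0 ?subr_gt0.
have d1 : d <= r / 2 * (p - q) by rewrite ge_min lexx.
have d2 : d <= (p - 1) / 2 by rewrite ge_min lexx orbT.
have d3 : d < p - 1 by apply: (le_lt_trans d2); rewrite ltr_pdivrMr//; lra.
pose s := (1 + d) / p.
have rs : r < s.
  have : r < p^-1 by rewrite -[r]invrK ltf_pV2 ?posrE ?invr_gt0.
  move=> /lt_trans; apply; rewrite /s -[X in X < _]mul1r ltr_pM2r ?invr_gt0//.
  by rewrite ltrDl.
have s1 : s < 1 by rewrite /s ltr_pdivrMr// mul1r; lra.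
have s0 : 0 < s := lt_trans r0 rs.
have B0 : 0 <= B.
  by apply: le_trans (HB 0%N); rewrite /dyadic_pvar sumr_ge0// => *; exact: powR_ge0.
have ge0 z := powR_ge0 2 z : 0 <= 2 `^ z :> R.
pose L := (C `^ (p - q) * B + 1) `^ p^-1.
have CB : 0 < C `^ (p - q) * B + 1.
  by rewrite ltr_wpDl// mulr_ge0// powR_ge0.
have L0 : 0 < L by rewrite powR_gt0.
apply: (@xNB (s - r) p); first by rewrite subr_gt0.
  rewrite addrC subrK pr andbT -[ltRHS]invrK ltf_pV2 ?posrE ?invr_gt0//.
  by rewrite /s -[X in X < _]mul1r ltr_pM2r ?invr_gt0// ltrDl.
rewrite addrC subrK.
apply: (@besov_oo_of_increments R x p s L xc (ltW p1) _ L0) => [|n].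
  by rewrite s0.
rewrite /lp_le.
apply: (@le_trans _ _ ((C * (2 `^ (- (r / 2))) ^+ n) `^ (p - q) * B)).
  apply: (@le_trans _ _ ((C * (2 `^ (- (r / 2))) ^+ n) `^ (p - q) * dyadic_pvar x q n)).
    rewrite /dyadic_pvar mulr_sumr; apply: ler_sum_nat => k /andP[_ kn].
    have -> : p = (p - q) + q by rewrite subrK.
    rewrite powRD; last by rewrite subrK gt_eqF.
    rewrite ler_wpM2r ?powR_ge0// addrK ge0_ler_powR ?nnegrE ?subr_ge0 ?(ltW qp)//.
      by rewrite mulr_ge0// exprn_ge0.
    exact: xC.
  by rewrite ler_wpM2l ?powR_ge0.
rewrite !powRM ?exprn_ge0 ?(ltW L0)//.
rewrite !(powR_exprn _ _ (ge0 _)) -[L `^ p]powRrM mulVf ?gt_eqF// powRr1 ?(ltW CB)//.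
rewrite [leRHS]mulrCA -exprMn mulrAC.
apply: (@le_trans _ _ ((C `^ (p - q) * B + 1) * ((2 `^ (- (r / 2))) `^ (p - q)) ^+ n)).
  by rewrite ler_wpM2r ?exprn_ge0 ?powR_ge0// lerDl.
rewrite ler_wpM2l ?(ltW CB)// lerXn2r ?nnegrE ?mulr_ge0 ?powR_ge0//.
have two : 2 * 2 `^ (- s * p) = 2 `^ (1 - s * p) :> R.
  rewrite powRD; last by apply/implyP.
  by rewrite powRr1// mulNr.
rewrite -!powRrM two; apply: ler_powR; first by rewrite ler1n.
have : s * p = 1 + d by rewrite /s divfK ?gt_eqF.
lra.
Qed.

Lemma pvar_finite_above (p : R) : r^-1 < p ->
  limn_esup (fun n => (dyadic_pvar x p n)%:E) != +oo%E.
Proof.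
move=> rp; apply/limn_esup_ltyP.
have p0 : 0 < p by apply: lt_trans rp; rewrite invr_gt0.
have g0 : 0 < p^-1 < r by rewrite invr_gt0 p0 -[ltRHS]invrK ltf_pV2 ?posrE ?invr_gt0.
have [C C0 xC] := besov_increments xc r01 xB g0.
exists (C `^ p); apply: (pvar_bounded C0 _ p0 xC).
by rewrite mulVf ?gt_eqF.
Qed.

Lemma qstar_eq : qstar x = (r^-1)%:E.
Proof.
apply/eqP; rewrite eq_le; apply/andP; split.
  apply: ge_ereal_sup => _ [p [p0 pinf] <-]; rewrite lee_fin leNgt.
  by apply/negP => /pvar_finite_above; rewrite pinf eqxx.
rewrite leNgt; apply/negP => lt.
have inS (q : R) : 0 < q < r^-1 -> (q%:E <= qstar x)%E.
  move=> q01; apply: ereal_sup_ubound; exists q => //; split.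
    by case/andP: q01.
  exact: pvar_infinite_below.
have h0 : 0 < r^-1 / 2 < r^-1.
  by rewrite divr_gt0 ?invr_gt0//= ltr_pdivrMr//; have := r1; lra.
have := inS _ h0; move: lt.
case E : (qstar x) => [t||]//; rewrite lte_fin lee_fin => tr ht.
have t0 : 0 < t by apply: lt_le_trans ht; case/andP: h0.
have := inS ((t + r^-1) / 2); rewrite E lee_fin => H.
have /H : 0 < (t + r^-1) / 2 < r^-1.
  by rewrite ltr_pdivrMr// divr_gt0//=; lra.
by rewrite ler_pdivrMr//; lra.
Qed.

End critical_exponent.

Theorem theorem6p2 (R : realType) (x : R -> R)
  (x_cont : {within `[0, 1], continuous x})
  (x_nonconst : ~ exists c : R, forall t : R, t \in `[0, 1] -> x t = c)
  (r : R) (r01 : 0 < r < 1)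
  (x_besov :
    ((\bigcap_(ep in [set ep : R * R | 0 < ep.1 /\ 1 <= ep.2])
        besov_oo (r - ep.1) ep.2)
     `\`
     (\bigcup_(ep in [set ep : R * R |
                       0 < ep.1 /\ (r + ep.1)^-1 < ep.2 < r^-1])
        besov_oo (r + ep.1) ep.2)) x) :
  Rminus x = r%:E.
Proof.
case: x_besov => xB xNB.
rewrite /Rminus (qstar_eq x_cont r01); first last.
- by move=> e p e0 ep xep; apply: xNB; exists (e, p).
- by move=> e p e0 p1; apply: (xB (e, p)).
have r0 : 0 < r by case/andP: r01.
by rewrite inver invr_eq0 gt_eqF// invrK.
Qed.
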